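(* Let $$\theta(\xi,\zeta,z)=\sum_{J\subset\{1,\dots,M\},\ I\subset\{1,\dots,N\}}\Bigl(\prod_{j\in J}\exp(\xi_j)\Bigr)\,\zeta^I\,(\mathbb D_{I^c}\widetilde\theta)\Bigl(z+\sum_{j\in J}\nu_j\Bigr),\qquad (\xi,\zeta,z)\in\mathbb C^M\times\mathbb C^N\times\mathbb C^{\widetilde g}.$$ Then the quasi-periodicity relations of $\theta$ are the same as the standard ones of $\widetilde\theta$: for every $\alpha=1,\dots,\widetilde g$, $$\theta(\xi+Y_\alpha,\ \zeta+W_\alpha,\ z+Z_\alpha)=\theta(\xi,\zeta,z)\,\exp\bigl(-2\pi\sqrt{-1}\,z_\alpha-\pi\sqrt{-1}\,Z_{\alpha\alpha}\bigr).$$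
   Context: Let $X$ be an irreducible singular curve with desingularisation $\widetilde X$, a compact connected Riemann surface of genus $\widetilde g$, with a standard (symplectic) homology basis of A-cycles and B-cycles. Let $p_{i,1},\dots,p_{i,j_i}\in\widetilde X$ be the preimages of the singular point $x_i$, $i=1,\dots,s$. One considers: - the basis $\omega_1,\dots,\omega_{\widetilde g}$ of holomorphic differentials on $\widetilde X$ with A-periods $A_j(\omega_i)=\delta_{i,j}$ and B-period matrix $Z=(Z_{j,i})$, $B_j(\omega_i)=Z_{j,i}$; $Z_\alpha$ denotes its $\alpha$-th row; - one-forms $\omega^S_{i,j}$ ($j=2,\dots,j_i$), with simple poles only at $p_{i,1},p_{i,j}$, residues $-1$ at $p_{i,1}$ and $+1$ at $p_{i,j}$, and zero A-periods; re-index them as $\omega^S_1,\dots,\omega^S_M$, and let $Y_\alpha=(Y_{\alpha,1},\dots,Y_{\alpha,M})$ be their periods over the $\alpha$-th B-cycle; - one-forms $\omega^S_{i,j,h}$ with a single pole, at $p_{i,j}$, of order at least two, with zero residue and zero A-periods; re-index them by $1,\dots,N$, and let $W_\alpha=(W_{1,\alpha},\dots,W_{N,\alpha})$ be their periods over the $\alpha$-th B-cycle. Define $\nu_j\in\mathbb C^{\widetilde g}$ ($j=1,\dots,M$) by $Y_{\alpha,j}=2\pi\sqrt{-1}\,(\nu_j)_\alpha$, i.e. $2\pi\sqrt{-1}\,\nu_j$ is the $j$-th column of $Y$. $\widetilde\theta$ is the Riemann theta function on $\mathbb C^{\widetilde g}$ with period matrix $Z$; it satisfies $\widetilde\theta(z+e_\alpha)=\widetilde\theta(z)$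 ($e_\alpha$ the standard basis vectors) and $\widetilde\theta(z+Z_\alpha)=\widetilde\theta(z)\exp(-2\pi\sqrt{-1}z_\alpha-\pi\sqrt{-1}Z_{\alpha\alpha})$. For $i=1,\dots,N$ set $\mathbb D_i=\sum_{\mu=1}^{\widetilde g}\frac{W_{i,\mu}}{2\pi\sqrt{-1}}\frac{\partial}{\partial z_\mu}$. For $I\subset\{1,\dots,N\}$ set $I^c=\{1,\dots,N\}\setminus I$, $\zeta^I=\prod_{i\in I}\zeta_i$, $\mathbb D_I=\prod_{i\in I}\mathbb D_i$ (with $\zeta^\emptyset=1$, $\mathbb D_\emptyset=\mathrm{id}$). *)

(* Defs.v *)
From HB Require Import structures.
From mathcomp Require Import all_boot all_order all_algebra.
From mathcomp Require Import complex.
From mathcomp Require Import all_classical all_reals all_analysis.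
From mathcomp.analysis.showcase Require summability.

Set Implicit Arguments.
Unset Strict Implicit.
Unset Printing Implicit Defensive.
Import Order.TTheory GRing.Theory Num.Theory.
Import numFieldNormedType.Exports.

Local Open Scope ring_scope.
Local Open Scope complex_scope.

Section RiemannTheta.
Variable R : realType.
Local Notation C := R[i].

Definition cexp (z : C) : C :=
  (expR (complex.Re z))%:C * (cos (complex.Im z) +i* sin (complex.Im z)).

Definition pii : C := 0 +i* (pi : R).

Definition siegel (g : nat) (Z : 'M[C]_g) : Prop :=
  Z^T = Z /\
  forall x : 'rV[R]_g, x != 0 ->
    0 < (x *m map_mx (@complex.Im R) Z *m x^T) 0 0.

Definition theta_term (g : nat) (Z : 'M[C]_g) (z : 'rV[C]_g)
    (n : 'rV[int]_g) : C :=
  let nC : 'rV[C]_g := map_mx intr n in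
  cexp (pii * (nC *m Z *m nC^T) 0 0 + 2 * pii * (nC *m z^T) 0 0).

(* The sum over Z^g is the limit of the finite partial sums along the directed
   set of finite subsets of Z^g; the series converges absolutely when Z is in
   the Siegel upper half-space. *)
Definition riemann_theta (g : nat) (Z : 'M[C]_g) (z : 'rV[C]_g) : C^o :=
  @summability.sum 'rV[int]_g C C^o (theta_term Z z).

(* The derivatives are complex ones: 'D_v is taken over the field C. *)
Definition period_derivation (g N : nat) (W : 'M[C]_(N, g)) (i : 'I_N)
    (f : 'rV[C]_g -> C^o) (z : 'rV[C]_g) : C^o :=
  \sum_(mu < g) W i mu / (2 * pii) * 'D_(delta_mx 0 mu) f z.

(* The composite of the operators indexed by I, in increasing order of the
   index; they commute on holomorphic functions. *)
Definition period_derivations (g N : nat) (W : 'M[C]_(N, g)) (I : {set 'I_N})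
    (f : 'rV[C]_g -> C^o) : 'rV[C]_g -> C^o :=
  foldr (period_derivation W) f (enum I).

Definition extended_theta (g M N : nat) (Z : 'M[C]_g) (W : 'M[C]_(N, g))
    (nu : 'I_M -> 'rV[C]_g)
    (xi : 'rV[C]_M) (zeta : 'rV[C]_N) (z : 'rV[C]_g) : C :=
  \sum_(J : {set 'I_M}) \sum_(I : {set 'I_N})
    (\prod_(j in J) cexp (xi 0 j)) * (\prod_(i in I) zeta 0 i) *
    period_derivations W (~: I) (riemann_theta Z) (z + \sum_(j in J) nu j).

End RiemannTheta.

(* Main.v *)
Require Import Defs.
From HB Require Import structures.
From mathcomp Require Import all_boot all_order all_algebra.
From mathcomp Require Import complex.
From mathcomp Require Import all_classical all_reals all_analysis.
From mathcomp Require Import finmap zify ring lra.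
From mathcomp.analysis.showcase Require summability.

Set Implicit Arguments.
Unset Strict Implicit.
Unset Printing Implicit Defensive.
Import Order.TTheory GRing.Theory Num.Theory.
Import numFieldNormedType.Exports.

Local Open Scope ring_scope.
Local Open Scope complex_scope.

(** The statement reduces to a relabelling of the lattice. Write the Riemann
    theta function as a sum over lattice points [n] of the exponentials
    [theta_term Z z n]. Each of these is an eigenvector of the derivation [D_i],
    with eigenvalue [(W n)_i], because the factors [2 pi i] cancel. Hence, for a
    fixed subset [J], the sum over [I] of [zeta^I D_(~: I) theta] is the single
    series ([sum_period_derivations])
      sum over n of prod over i of (zeta_i + (W n)_i) times theta_term Z w n,
    where [w] is [z] plus the sum of the [nu j], [j] in [J].

    Translating [zeta] by [W_alpha] turns the product at [n] into the product at
    [n + e_alpha]; translating [w] by the row [Z_alpha] turns the term at [n]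
    into the term at [n + e_alpha], times the automorphy factor at [w]
    ([theta_term_period]). An unconditional sum does not change when its index
    set is relabelled, so the series is multiplied by the automorphy factor at
    [w] ([theta_series_period]). This factor differs from the one at [z] by
    the product over [J] of the exponentials of [- 2 pi i (nu j)_alpha], which
    is exactly what the translation of [xi] by [Y_alpha] compensates.

    The analysis consists in justifying convergence and differentiation term by
    term, to every order, in the complex sense. This is done for all theta
    series with coefficients bounded by an exponential of the l1 norm of [n], a
    class stable under multiplication by linear forms in [n]. Since the
    quadratic form defined by the imaginary part of [Z] has a positive minimum
    on the unit sphere ([posdef_coercive]), the terms are dominated by
    Gaussians, which beat any such exponential ([theta_majorant]). The explicit
    quadratic Taylor remainder of the exponential ([cexp_taylor2]) then
    dominates the error of the difference quotients ([derive_theta_series]). *)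

Import ComplexField.Normc.

(** * The complex exponential *)

Section ComplexExponential.
Variable R : realType.
Local Notation C := R[i].
Implicit Types (z w : C) (x y : R).

Lemma normcE z : `|z| = (normc z)%:C.
Proof. by []. Qed.

Lemma normc_ge0 z : 0 <= normc z.
Proof. by rewrite -ler0c -normcE. Qed.

Lemma ler_normcD z w : normc (z + w) <= normc z + normc w.
Proof. by rewrite -lecR rmorphD /= -!normcE ler_normD. Qed.

Lemma normc_real x : normc x%:C = `|x|.
Proof. by rewrite /= expr0n /= addr0 sqrtr_sqr. Qed.

Lemma normc_ge_Re z : `|complex.Re z| <= normc z.
Proof.
by case: z => a b /=; rewrite -sqrtr_sqr ler_wsqrtr // lerDl sqr_ge0.
Qed.

Lemma normc_ge_Im z : `|complex.Im z| <= normc z.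
Proof.
by case: z => a b /=; rewrite -sqrtr_sqr ler_wsqrtr // lerDr sqr_ge0.
Qed.

Lemma normc_le_ReIm z : normc z <= `|complex.Re z| + `|complex.Im z|.
Proof.
case: z => a b /=; rewrite -(@ger0_norm _ (`|a| + `|b|)) ?addr_ge0 //.
rewrite -sqrtr_sqr ler_wsqrtr // sqrrD !real_normK ?num_real //.
by rewrite addrAC lerDl mulrn_wge0 // mulr_ge0.
Qed.

Lemma normc_sum (I : Type) (r : seq I) (F : I -> C) :
  normc (\sum_(i <- r) F i) <= \sum_(i <- r) normc (F i).
Proof.
elim: r => [|i r IH]; first by rewrite !big_nil normc0.
by rewrite !big_cons (le_trans (ler_normcD _ _)) // lerD2l.
Qed.

Lemma cexpD z w : cexp (z + w) = cexp z * cexp w.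
Proof.
case: z w => a b [c d]; rewrite /cexp /= expRD cosD sinD.
by apply/eqP; rewrite eq_complex /=; apply/andP; split; apply/eqP; ring.
Qed.

Lemma cexp0 : cexp (0 : C) = 1.
Proof.
by rewrite /cexp /= expR0 cos0 sin0; apply/eqP; rewrite eq_complex /= !mul0r
  !mul1r subr0 addr0 !eqxx.
Qed.

Lemma cexp_sum (I : Type) (r : seq I) (P : pred I) (F : I -> C) :
  cexp (\sum_(i <- r | P i) F i) = \prod_(i <- r | P i) cexp (F i).
Proof. by apply: (big_morph _ cexpD cexp0). Qed.

Lemma normc_cexp z : normc (cexp z) = expR (complex.Re z).
Proof.
by rewrite /cexp normcM normc_real ger0_norm ?expR_ge0 //= cos2Dsin2 sqrtr1
  mulr1.
Qed.

Lemma ler_dist_MVT (f df : R -> R) (M y : R) :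
  (forall x, is_derive x 1 f (df x)) ->
  (forall x, `|x| <= `|y| -> `|df x| <= M) -> `|f y - f 0| <= M * `|y|.
Proof.
move=> fdf dfM.
have fc : continuous f.
  move=> x; apply: differentiable_continuous; apply/derivable1_diffP.
  by have [] := fdf x.
have [y0|y0|->] := ltgtP y 0; last by rewrite subrr normr0 mulr0.
- have [|c] := MVT y0 (fun x _ => fdf x); first exact: continuous_subspaceT.
  rewrite in_itv /= => /andP[yc c0] E.
  rewrite distrC E normrM sub0r normrN ler_wpM2r // dfM //.
  by rewrite !ltr0_norm // lerN2 ltW.
- have [|c] := MVT y0 (fun x _ => fdf x); first exact: continuous_subspaceT.
  rewrite in_itv /= => /andP[c0 cy] E.
  rewrite E normrM subr0 ler_wpM2r // dfM //.
  by rewrite !gtr0_norm // ltW.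
Qed.

Lemma normr_sin_le y : `|sin y| <= `|y|.
Proof.
have := @ler_dist_MVT sin cos 1 y (@is_derive_sin _).
rewrite sin0 subr0 mul1r; apply=> x _.
by rewrite ler_norml cos_geN1 cos_le1.
Qed.

Lemma normr_cosB1_le y : `|cos y - 1| <= `|y| ^+ 2.
Proof.
have := @ler_dist_MVT cos (fun x => - sin x) `|y| y (@is_derive_cos _).
rewrite cos0 -expr2; apply=> x xy.
by rewrite normrN (le_trans (normr_sin_le x)).
Qed.

Lemma normr_cosB1_le1 y : `|cos y - 1| <= `|y|.
Proof.
have := @ler_dist_MVT cos (fun x => - sin x) 1 y (@is_derive_cos _).
rewrite cos0 mul1r; apply=> x xy.
by rewrite normrN ler_norml sin_geN1 sin_le1.
Qed.

Lemma normr_sinBid_le y : `|sin y - y| <= `|y| ^+ 2.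
Proof.
have := @ler_dist_MVT (sin - id) (fun x => cos x - 1) `|y| y.
have -> : forall x, (sin - id) x = sin x - x :> R by [].
have -> : forall x, (sin - id) x = sin x - x :> R by [].
rewrite -expr2 sin0 !subr0.
by apply=> x xy; exact: le_trans (normr_cosB1_le1 x) _.
Qed.

(** Multiply [1 - x <= expR (- x)] by [expR x]. *)
Lemma expRB1_le x : expR x - 1 <= x * expR x.
Proof.
have := ler_wpM2l (expR_ge0 x) (expR_ge1Dx (- x)).
by rewrite expRN divff ?gt_eqF ?expR_gt0 //; lra.
Qed.

Lemma normr_expRB1_le x : `|expR x - 1| <= `|x| * expR `|x|.
Proof.
have h1 := expRB1_le x; have h2 := expR_ge1Dx x.
have [x0|x0] := leP 0 x; first by rewrite (ger0_norm x0) ger0_norm; lra.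
have h3 : 1 <= expR (- x) by rewrite -expR0 ler_expR; lra.
rewrite (ltr0_norm x0) ltr0_norm ?subr_lt0 ?expR_lt1 //.
have : - x <= - x * expR (- x) by rewrite ler_peMr //; lra.
lra.
Qed.

Lemma normr_expRB1Bid_le x : `|expR x - 1 - x| <= `|x| ^+ 2 * expR `|x|.
Proof.
have h1 := expRB1_le x; have h2 := expR_ge1Dx x.
rewrite ger0_norm; last by lra.
apply: (@le_trans _ _ (x * (expR x - 1))); first by lra.
apply: (le_trans (ler_norm _)).
by rewrite normrM expr2 -mulrA ler_wpM2l // normr_expRB1_le.
Qed.

(** Unlike a bare differentiability statement, this explicit quadratic remainder
    can be summed over infinitely many exponents at once. The proof compares
    real and imaginary parts with the one-variable estimates above. *)
Lemma cexp_taylor2 w :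
  normc (cexp w - 1 - w) <= 4 * normc w ^+ 2 * expR (normc w).
Proof.
set r := normc w; have r0 : 0 <= r := normc_ge0 w.
have xr := normc_ge_Re w; have yr := normc_ge_Im w; rewrite -/r in xr yr.
apply: (le_trans (normc_le_ReIm _)).
move: xr yr; case: (w) => x y /= xr yr.
rewrite mul0r subr0 !oppr0 addr0 mul0r addr0.
have er : expR `|x| <= expR r by rewrite ler_expR.
have er1 : 1 <= expR r by rewrite -expR0 ler_expR.
have ex : expR x <= expR r by rewrite ler_expR (le_trans (ler_norm _)).
have sqx : `|x| ^+ 2 <= r ^+ 2 by rewrite lerXn2r ?nnegrE.
have sqy : `|y| ^+ 2 <= r ^+ 2 by rewrite lerXn2r ?nnegrE.
have r20 : 0 <= r ^+ 2 by rewrite exprn_ge0.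
have h1 : `|expR x * cos y - 1 - x| <= 2 * (r ^+ 2 * expR r).
  rewrite (_ : _ - x = (cos y - 1) * expR x + (expR x - 1 - x)); last by ring.
  apply: (le_trans (ler_normD _ _)); rewrite mulr_natl mulr2n lerD //.
    rewrite normrM (ger0_norm (expR_ge0 x)) ler_pM ?expR_ge0 //.
    exact: le_trans (normr_cosB1_le y) sqy.
  apply: (le_trans (normr_expRB1Bid_le x)).
  by rewrite ler_pM ?exprn_ge0 ?expR_ge0.
have h2 : `|expR x * sin y - y| <= 2 * (r ^+ 2 * expR r).
  rewrite (_ : _ - y = (expR x - 1) * sin y + (sin y - y)); last by ring.
  apply: (le_trans (ler_normD _ _)); rewrite mulr_natl mulr2n lerD //.
    rewrite normrM expr2 mulrAC ler_pM //.
      apply: (le_trans (normr_expRB1_le x)).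
      by rewrite ler_pM ?expR_ge0.
    exact: le_trans (normr_sin_le y) yr.
  apply: (le_trans (normr_sinBid_le y)); apply: (le_trans sqy).
  by rewrite ler_peMr.
by move: h1 h2; lra.
Qed.

End ComplexExponential.

(** * Unconditional sums of complex families *)

#[local] Existing Instance summability.totally_filter.

Section UnconditionalSums.
Variables (R : realType) (I : choiceType).
Local Notation C := R[i].
Implicit Types (x y : I -> C) (s t : C) (A B : {fset I}).

(** Convergence along the directed set of finite subsets, with a real
    tolerance: the topology of [C^o] is given by balls whose radii are complex
    numbers, and estimates are more convenient with real moduli. *)
Definition has_sum x s : Prop :=
  forall e : R, 0 < e -> exists A, forall B, (A `<=` B)%fset ->
    normc (s - \sum_(i <- B) x i) < e.

Lemma partial_sumE (V : zmodType) (x : I -> V) A :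
  summability.partial_sum x A = \sum_(i <- A) x i.
Proof. by rewrite /summability.partial_sum big_seq_fsetE. Qed.

Lemma sum_has_sum x s :
  has_sum x s -> @summability.sum I C C^o x = s.
Proof.
move=> xs; apply: cvg_lim; first exact: norm_hausdorff.
apply/cvgrPdist_lt => -[e e'] /[dup] /ltW/ger0_Im /= ->; rewrite ltcR => e0.
have [A AP] := xs e e0.
exists A => // B /= AB.
by rewrite partial_sumE [X in X < _]normcE ltcR AP.
Qed.

Lemma has_sumD x y s t :
  has_sum x s -> has_sum y t -> has_sum (fun i => x i + y i) (s + t).
Proof.
move=> xs yt e e0; have e20 : 0 < e / 2 by rewrite divr_gt0.
have [A AP] := xs _ e20; have [B BP] := yt _ e20.
exists (A `|` B)%fset => D; rewrite fsubUset => /andP[AD BD].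
rewrite big_split /= opprD addrACA (le_lt_trans (ler_normcD _ _)) //.
by rewrite (splitr e) ltrD ?AP ?BP.
Qed.

Lemma has_sumZ x s (a : C) : has_sum x s -> has_sum (fun i => a * x i) (a * s).
Proof.
move=> xs e e0.
have a0 : 0 < normc a + 1 by rewrite ltr_wpDl ?normc_ge0.
have [A AP] := xs _ (divr_gt0 e0 a0).
exists A => B /AP; rewrite -mulr_sumr -mulrBr normcM ltr_pdivlMr // => h.
apply: le_lt_trans h; rewrite mulrC ler_wpM2l ?normc_ge0 //; lra.
Qed.

Lemma has_sum0 : has_sum (fun=> 0) 0.
Proof. by move=> e e0; exists fset0 => B _; rewrite big1 // subr0 normc0. Qed.

Lemma has_sum_sum (J : Type) (r : seq J) (x : J -> I -> C) (s : J -> C) :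
  (forall j, has_sum (x j) (s j)) ->
  has_sum (fun i => \sum_(j <- r) x j i) (\sum_(j <- r) s j).
Proof.
move=> xs; elim: r => [|j r IH].
  rewrite big_nil (_ : (fun i => _) = fun=> 0); first exact: has_sum0.
  by apply/funext => i; rewrite big_nil.
rewrite big_cons (_ : (fun i => _) = fun i => x j i + \sum_(j <- r) x j i).
  exact: has_sumD.
by apply/funext => i; rewrite big_cons.
Qed.

(** Absolute convergence with an explicit constant: the constant is what
    survives a passage to the limit in [normc_has_sum_le]. *)
Definition sum_bounded_by x (K : R) : Prop :=
  forall A, \sum_(i <- A) normc (x i) <= K.

Lemma ler_sum_fsubset (u : I -> R) A B : (forall i, 0 <= u i) ->
  (A `<=` B)%fset -> \sum_(i <- A) u i <= \sum_(i <- B) u i.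
Proof.
move=> u0 AB; rewrite (big_fsetID _ (mem A) B) /=.
rewrite (_ : [fset i in B | i \in A]%fset = A); last first.
  by apply/fsetP => i; rewrite !inE andb_idl // => /(fsubsetP AB).
by rewrite lerDl sumr_ge0.
Qed.

(** The sum is the supremum of the finite partial sums, which increase with the
    finite set. *)
Lemma has_sum_real_ge0 (u : I -> R) (K : R) : (forall i, 0 <= u i) ->
  (forall A, \sum_(i <- A) u i <= K) ->
  exists s, has_sum (fun i => (u i)%:C) s.
Proof.
move=> u0 uK; pose S := [set \sum_(i <- A) u i | A in [set: {fset I}]]%classic.
have supS : has_sup S.
  split; first by exists (\sum_(i <- fset0) u i); exists fset0.
  by exists K => _ [A _ <-].
exists (sup S)%:C => e e0.
have [_ [A _ <-] Ae] := sup_adherent e0 supS.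
exists A => B AB; rewrite -rmorph_sum -rmorphB normc_real ger0_norm.
  have := ler_sum_fsubset u0 AB; lra.
by rewrite subr_ge0 sup_upper_bound //; exists B.
Qed.

(** The family is the difference of the nonnegative families [u + `|u|] and
    [`|u|]. *)
Lemma has_sum_real_bounded (u : I -> R) (K : R) :
  (forall A, \sum_(i <- A) `|u i| <= K) ->
  exists s, has_sum (fun i => (u i)%:C) s.
Proof.
move=> uK.
have [s sP] := has_sum_real_ge0 (fun i => normr_ge0 (u i)) uK.
have [||t tP] := @has_sum_real_ge0 (fun i => u i + `|u i|) (K + K).
- by move=> i; have := ler_norm (- u i); rewrite normrN; lra.
- move=> A; rewrite big_split /= lerD //; apply: le_trans (uK A).
  by apply: ler_sum => i _; exact: ler_norm.
exists (t + (-1) * s).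
rewrite (_ : (fun i => _) =
  fun i => (u i + `|u i|)%:C + (-1) * `|u i|%:C).
  by apply: has_sumD => //; exact: has_sumZ.
by apply/funext => i; rewrite rmorphD /= mulN1r addrK.
Qed.

Lemma has_sum_bounded x K : sum_bounded_by x K -> exists s, has_sum x s.
Proof.
move=> xK.
have [A|s sP] := @has_sum_real_bounded (fun i => complex.Re (x i)) K.
  by apply: le_trans (xK A); apply: ler_sum => i _; exact: normc_ge_Re.
have [A|t tP] := @has_sum_real_bounded (fun i => complex.Im (x i)) K.
  by apply: le_trans (xK A); apply: ler_sum => i _; exact: normc_ge_Im.
exists (s + 'i * t).
rewrite (_ : x = fun i => (complex.Re (x i))%:C + 'i * (complex.Im (x i))%:C).
  by apply: has_sumD => //; exact: has_sumZ.
by apply/funext => i; exact: complexE.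
Qed.

Lemma normc_has_sum_le x s K : has_sum x s -> sum_bounded_by x K ->
  normc s <= K.
Proof.
move=> xs xK; apply/ler_addgt0Pr => e e0; have [A AP] := xs _ e0.
have := AP _ (fsubset_refl A); have := xK A; have := normc_sum A x.
have := ler_normcD (s - \sum_(i <- A) x i) (\sum_(i <- A) x i).
rewrite subrK; lra.
Qed.

(** A finite set beyond [g @` A] is sent by [f] to a finite set beyond [A], so
    the limit along finite sets does not see the relabelling. *)
Lemma has_sum_reindex (f g : I -> I) x s : cancel f g -> cancel g f ->
  has_sum x s -> has_sum (x \o f) s.
Proof.
move=> fK gK xs e e0; have [A AP] := xs _ e0.
exists [fset g i | i in A]%fset => B gAB.
have -> : \sum_(i <- B) (x \o f) i = \sum_(i <- [fset f i | i in B]%fset) x i.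
  by rewrite big_imfset //= => i j _ _; exact: can_inj fK _ _.
apply: AP; apply/fsubsetP => i iA; apply/imfsetP; exists (g i) => //=.
by apply: (fsubsetP gAB); apply/imfsetP; exists i.
Qed.

End UnconditionalSums.

(** * Gaussian majorants on the integer lattice *)

Section GaussianMajorant.
Variable R : realType.
Local Notation C := R[i].

Lemma continuous_sum (T : topologicalType) (J : Type) (r : seq J)
  (f : J -> T -> R) : (forall j, continuous (f j)) ->
  continuous (fun x => \sum_(j <- r) f j x).
Proof.
move=> fc; elim: r => [|j r IH] x.
  rewrite (_ : (fun x => _) = fun=> 0); first exact: cvg_cst.
  by apply/funext => y; rewrite big_nil.
rewrite (_ : (fun x => _) = fun x => f j x + \sum_(j <- r) f j x).
  by apply: cvgD; [exact: fc | exact: IH].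
by apply/funext => y; rewrite big_cons.
Qed.

Lemma quadratic_formE (g : nat) (Q : 'M[R]_g) (x : 'rV[R]_g) :
  (x *m Q *m x^T) 0 0 = \sum_k \sum_j x 0 j * Q j k * x 0 k.
Proof.
by rewrite !mxE; apply: eq_bigr => k _; rewrite !mxE mulr_suml.
Qed.

(** The constant is the minimum of the form on the Euclidean unit sphere, which
    is compact; homogeneity extends the bound to all vectors. *)
Lemma posdef_coercive (g : nat) (Q : 'M[R]_g) :
  (forall x : 'rV[R]_g, x != 0 -> 0 < (x *m Q *m x^T) 0 0) ->
  exists2 m : R, 0 < m &
    forall x : 'rV[R]_g, m * (\sum_k x 0 k ^+ 2) <= (x *m Q *m x^T) 0 0.
Proof.
move=> Qpos.
pose nrm2 (x : 'rV[R]_g) := \sum_k x 0 k ^+ 2.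
pose q (x : 'rV[R]_g) := (x *m Q *m x^T) 0 0.
have nrm2_ge0 x : 0 <= nrm2 x by apply: sumr_ge0 => k _; exact: sqr_ge0.
have nrm2_eq0 x : nrm2 x = 0 -> x = 0.
  move=> /eqP; rewrite psumr_eq0 => [/allP h|k _]; last exact: sqr_ge0.
  apply/rowP => k; rewrite mxE; apply/eqP; rewrite -sqrf_eq0.
  by apply: h; rewrite mem_index_enum.
have coordc k : continuous (fun x : 'rV[R]_g => x 0 k).
  exact: coord_continuous.
have nrm2c : continuous nrm2.
  by apply: continuous_sum => k x; exact: (cvgM (coordc k x) (coordc k x)).
have qc : continuous q.
  rewrite (_ : q = fun x => \sum_k \sum_j x 0 j * Q j k * x 0 k).
    apply: continuous_sum => k; apply: continuous_sum => j x.
    exact: (cvgM (cvgM (coordc j x) (cvg_cst (Q j k))) (coordc k x)).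
  by apply/funext => x; exact: quadratic_formE.
pose S := [set x | nrm2 x = 1]%classic.
have scale x : x != 0 -> exists2 y, S y & q x = nrm2 x * q y.
  move=> x0; have n0 : 0 < nrm2 x.
    by rewrite lt_neqAle nrm2_ge0 eq_sym andbT; apply: contra_neq x0 => /nrm2_eq0.
  have s0 : Num.sqrt (nrm2 x) != 0 by rewrite gt_eqF // sqrtr_gt0.
  exists ((Num.sqrt (nrm2 x))^-1 *: x).
    rewrite /S /= {1}/nrm2; under eq_bigr do rewrite mxE exprMn.
    by rewrite -mulr_sumr exprVn sqr_sqrtr ?nrm2_ge0 // mulVf // gt_eqF.
  rewrite /q linearZ /= -!scalemxAl -scalemxAr scalerA !mxE.
  by rewrite -invfM -expr2 sqr_sqrtr // mulrA divff ?mul1r // gt_eqF.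
(* the sphere is empty in dimension zero *)
have [[x0 Sx0]|S0] := pselect (S !=set0)%classic; last first.
  exists 1 => // x; have [->|/scale[y Sy]] := eqVneq x 0.
    by rewrite mul0mx mul0mx mxE big1 ?mulr0 // => k _; rewrite mxE expr0n.
  by case: S0; exists y.
have cS : compact S.
  apply: bounded_closed_compact.
    exists 1; split=> // M M1 x Sx; rewrite /= {1}/Num.norm /= mx_normrE.
    apply: bigmax_le => [|[a k] _ /=]; first exact: le_trans (ltW M1).
    rewrite (le_trans _ (ltW M1)) // ord1 -(@expr_le1 _ 2) //.
    rewrite real_normK ?num_real // -Sx /nrm2 (bigD1 k) //= lerDl.
    by apply: sumr_ge0 => j _; exact: sqr_ge0.
  apply: (@closed_comp _ _ nrm2 [set y | y = 1]%classic); last exact: closed_eq.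
  by move=> x _; exact: nrm2c.
have [c cS' cmin] := EVT_min_rV (ex_intro _ x0 Sx0) cS
  (continuous_subspaceT qc).
exists (q c).
  apply: Qpos; apply/eqP => c0; move: cS'; rewrite c0 => /set_mem.
  rewrite /S /= /nrm2 big1 => [/eqP|k _]; first by rewrite eq_sym oner_eq0.
  by rewrite mxE expr0n.
move=> x; have [->|/scale[y Sy]] := eqVneq x 0.
  by rewrite mul0mx mul0mx mxE big1 ?mulr0 // => k _; rewrite mxE expr0n.
rewrite -/(q x) -/(nrm2 x) => ->; rewrite mulrC ler_wpM2l // cmin //.
exact: mem_set.
Qed.

(** Interleaving the two signs makes the code at most twice the absolute value,
    so that sums over the integers are dominated by geometric sums. *)
Definition int_code (m : int) : nat :=
  match m with Posz k => k.*2 | Negz k => k.*2.+1 end.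

Lemma int_code_inj : injective int_code.
Proof.
by move=> [m|m] [n|n] /= h; (congr Posz || congr Negz || exfalso); lia.
Qed.

Lemma int_code_le (m : int) : (int_code m)%:R / 2 <= `|m|%:~R :> R.
Proof.
rewrite ler_pdivrMr //; case: m => k /=.
  have -> : `|Posz k|%:~R = k%:R :> R by [].
  by rewrite -natrM ler_nat; lia.
have -> : `|Negz k|%:~R = k.+1%:R :> R by [].
by rewrite -natrM ler_nat; lia.
Qed.

(** Coding the coordinates by natural numbers embeds a finite set of lattice
    points into a box, and over a box the sum factors into [g] partial sums of
    a geometric series with ratio [r]. *)
Lemma exp_norm_sum_bounded (g : nat) : exists K : R,
  forall A : {fset 'rV[int]_g},
    \sum_(n <- A) expR (- \sum_k `|n 0 k|%:~R) <= K.
Proof.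
pose r : R := expR (- 2^-1).
have r0 : 0 < r by exact: expR_gt0.
have r1 : r < 1 by rewrite expR_lt1 oppr_lt0 invr_gt0.
exists (((1 - r)^-1) ^+ g) => A.
(* any bound on all the codes that occur; their total is one *)
pose L := (\sum_(n <- A) \sum_k int_code (n 0%R k))%N.
have LP n k : n \in A -> (int_code (n 0%R k) < L.+1)%N.
  move=> nA; rewrite ltnS /L (big_fsetD1 n) //= (bigD1 k) //=.
  by rewrite -addnA leq_addr.
pose phi (n : 'rV[int]_g) : {ffun 'I_g -> 'I_L.+1} :=
  [ffun k => inord (int_code (n 0 k))].
have phi_inj : {in A &, injective phi}.
  move=> n n' nA n'A /ffunP h; apply/rowP => k; apply: int_code_inj.
  by have := congr1 (@nat_of_ord _) (h k); rewrite !ffunE !inordK ?LP.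
pose G (f : {ffun 'I_g -> 'I_L.+1}) : R := \prod_k r ^+ f k.
have G0 f : 0 <= G f by apply: prodr_ge0 => k _; rewrite exprn_ge0 // ltW.
apply: (@le_trans _ _ (\sum_(n <- A) G (phi n))).
  rewrite big_seq [leRHS]big_seq; apply: ler_sum => n nA.
  rewrite -sumrN expR_sum; apply: ler_prod => k _; rewrite expR_ge0 /=.
  rewrite ffunE inordK ?LP // -expRM_natr ler_expR mulNr lerN2 mulrC.
  exact: int_code_le.
rewrite -(big_map phi xpredT G) big_uniq; last first.
  by rewrite map_inj_in_uniq ?fset_uniq.
apply: (@le_trans _ _ (\sum_f G f)).
  by rewrite big_mkcond; apply: ler_sum => f _; case: ifP.
rewrite -(bigA_distr_bigA (fun (_ : 'I_g) (j : 'I_L.+1) => r ^+ j)).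
rewrite prodr_const card_ord lerXn2r ?nnegrE ?invr_ge0 ?subr_ge0 ?(ltW r1) //.
  by apply: sumr_ge0 => j _; rewrite exprn_ge0 // ltW.
have := @geometric_le_lim R L.+1 1 r ler01 r0.
rewrite ger0_norm ?(ltW r0) // mul1r => /(_ r1); rewrite /series /= big_mkord.
by apply: le_trans; apply: ler_sum => i _; rewrite /geometric /= mul1r.
Qed.

End GaussianMajorant.

(** * Theta series with coefficients of exponential type *)

Section ThetaSeries.
Variables (R : realType) (g : nat).
Local Notation C := R[i].
Implicit Types (Z : 'M[C]_g) (z v : 'rV[C]_g) (n : 'rV[int]_g).
Implicit Types (c : 'rV[int]_g -> C).

Definition l1norm n : R := \sum_k `|n 0 k|%:~R.

Definition pairing n v : C := (map_mx intr n *m v^T) 0 0.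

Lemma l1norm_ge0 n : 0 <= l1norm n.
Proof. by apply: sumr_ge0 => k _; rewrite ler0z. Qed.

Lemma pairingE n v : pairing n v = \sum_k (n 0 k)%:~R * v 0 k.
Proof. by rewrite /pairing mxE; apply: eq_bigr => k _; rewrite !mxE. Qed.

Lemma pairingDr n v w : pairing n (v + w) = pairing n v + pairing n w.
Proof. by rewrite /pairing linearD /= mulmxDr mxE. Qed.

Lemma pairingZr n a v : pairing n (a *: v) = a * pairing n v.
Proof. by rewrite /pairing linearZ /= -scalemxAr mxE. Qed.

Lemma intr_realc (m : int) : m%:~R = (m%:~R)%:C :> C.
Proof. by rewrite rmorph_int. Qed.

Lemma normc_pairing_le n v : normc (pairing n v) <= (\sum_k normc (v 0 k)) * l1norm n.
Proof.
rewrite pairingE (le_trans (normc_sum _ _)) // /l1norm mulr_sumr.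
apply: ler_sum => k _; rewrite intr_realc normcM normc_real mulrC intr_norm.
rewrite ler_wpM2r // (bigD1 k) //= lerDl.
by apply: sumr_ge0 => j _; exact: normc_ge0.
Qed.

Lemma theta_termE Z z n :
  theta_term Z z n =
  cexp (pii R * (map_mx intr n *m Z *m (map_mx intr n)^T) 0 0
        + 2 * pii R * pairing n z).
Proof. by []. Qed.

Lemma theta_term_translate Z z v n :
  theta_term Z (z + v) n = theta_term Z z n * cexp (2 * pii R * pairing n v).
Proof. by rewrite !theta_termE pairingDr mulrDr addrA cexpD. Qed.

Lemma Im_sum (J : Type) (r : seq J) (F : J -> C) :
  complex.Im (\sum_(j <- r) F j) = \sum_(j <- r) complex.Im (F j).
Proof.
apply: (big_morph (@complex.Im R)) => //.
by move=> [a b] [d e].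
Qed.

Lemma Im_quadratic_int Z n :
  complex.Im ((map_mx intr n *m Z *m (map_mx intr n)^T) 0 0) =
  (map_mx intr n *m map_mx (@complex.Im R) Z *m (map_mx intr n)^T) 0 0.
Proof.
rewrite !mxE Im_sum; apply: eq_bigr => k _; rewrite !mxE !mulr_suml Im_sum.
apply: eq_bigr => j _; rewrite !mxE !intr_realc.
by case: (Z j k) => a b /=; rewrite !(mul0r, mulr0, addr0, add0r, subr0).
Qed.

Lemma normc_theta_term Z z n :
  normc (theta_term Z z n) =
  expR (- (pi * (map_mx intr n *m map_mx (@complex.Im R) Z
                 *m (map_mx intr n)^T) 0 0)
        - 2 * pi * complex.Im (pairing n z)).
Proof.
rewrite theta_termE normc_cexp -Im_quadratic_int /pii; congr expR.
case: (_ 0 0) (pairing n z) => a b [d e] /=.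
ring.
Qed.

(** Completing the square: a Gaussian beats every exponential, with room for a
    summable factor. *)
Lemma gaussian_le (A mu t : R) : 0 < mu ->
  A * t - mu * t ^+ 2 <= (A + 1) ^+ 2 / (4 * mu) - t.
Proof.
move=> mu0; rewrite -subr_ge0.
rewrite (_ : _ - _ = mu * (t - (A + 1) / (2 * mu)) ^+ 2).
  by rewrite mulr_ge0 ?sqr_ge0 // ltW.
by field; rewrite gt_eqF.
Qed.

(** By [posdef_coercive] the modulus of a theta term is a Gaussian times an
    exponential in the [l1norm], hence by [gaussian_le], applied in each
    coordinate, it is at most a constant times [expR (- l1norm n)], even after
    multiplication by any [expR (B * l1norm n)]. *)
Lemma theta_majorant Z z (B : R) : siegel Z -> exists K : R,
  sum_bounded_by (fun n => (expR (B * l1norm n))%:C * theta_term Z z n) K.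
Proof.
move=> [_ /posdef_coercive[m m0 mP]].
have [K KP] := exp_norm_sum_bounded R g.
(* [A] collects the weight [B] and the linear term coming from [z] *)
pose S := \sum_k normc (z 0 k).
pose A := B + 2 * pi * S.
pose mu := pi * m.
have mu0 : 0 < mu by rewrite mulr_gt0 ?pi_gt0.
pose E := (A + 1) ^+ 2 / (4 * mu).
exists (expR (\sum_(k < g) E) * K) => F.
apply: (@le_trans _ _ (\sum_(n <- F) expR (\sum_(k < g) E) * expR (- l1norm n))).
  apply: ler_sum => n _; rewrite normcM normc_real ger0_norm ?expR_ge0 //.
  rewrite normc_theta_term -!expRD ler_expR.
  have h1 := mP (map_mx intr n).
  have h2 : - complex.Im (pairing n z) <= S * l1norm n.
    apply: le_trans (normc_pairing_le n z); apply: le_trans (normc_ge_Im _).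
    by rewrite -normrN ler_norm.
  have h3 : A * l1norm n - mu * (\sum_k (map_mx intr n : 'rV[R]_g) 0 k ^+ 2)
     <= \sum_(k < g) E - l1norm n.
    rewrite /l1norm !mulr_sumr -!sumrB; apply: ler_sum => k _.
    rewrite mxE -(@real_normK _ (n 0 k)%:~R) ?num_real // -intr_norm.
    exact: gaussian_le.
  apply: le_trans h3; rewrite /A /mu.
  move: h1 h2 (@pi_gt0 R) => /=; set q := (_ 0 0); set s := \sum_k _.
  set d := complex.Im _; set l := l1norm n => h1 h2 p0.
  have := ler_wpM2l (ltW p0) h1; have := ler_wpM2l (ltW p0) h2.
  by rewrite -/q -/d; lra.
by rewrite -mulr_sumr ler_wpM2l ?expR_ge0.
Qed.

(** A class of coefficients for which the theta series converges absolutely and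
    which is stable under multiplication by the linear forms in [n] that
    differentiation produces. *)
Definition exp_type c : Prop :=
  exists K B : R, 0 <= K /\ forall n, normc (c n) <= K * expR (B * l1norm n).

Definition theta_series Z c z : C^o :=
  @summability.sum 'rV[int]_g C C^o (fun n => c n * theta_term Z z n).

Lemma exp_type_sum_bounded Z c z : siegel Z -> exp_type c ->
  exists K, sum_bounded_by (fun n => c n * theta_term Z z n) K.
Proof.
move=> hZ [K [B [K0 KP]]]; have [L LP] := theta_majorant z B hZ.
exists (K * L) => A; apply: le_trans (ler_wpM2l K0 (LP A)).
rewrite mulr_sumr; apply: ler_sum => n _.
move: (theta_term Z z n) => t.
rewrite !normcM mulrA ler_wpM2r ?normc_ge0 //.
by rewrite normc_real ger0_norm ?expR_ge0.
Qed.

Lemma theta_seriesP Z c z : siegel Z -> exp_type c ->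
  has_sum (fun n => c n * theta_term Z z n) (theta_series Z c z).
Proof.
move=> hZ /(exp_type_sum_bounded z hZ)[K /has_sum_bounded[s sP]].
by rewrite /theta_series (sum_has_sum sP).
Qed.

Lemma exp_typeM c d : exp_type c -> exp_type d -> exp_type (fun n => c n * d n).
Proof.
move=> [K [B [K0 KP]]] [L [D [L0 LP]]]; exists (K * L), (B + D).
split=> [|n]; first exact: mulr_ge0.
rewrite normcM mulrDl expRD mulrACA ler_pM //; exact: normc_ge0.
Qed.

Lemma exp_typeD c d : exp_type c -> exp_type d -> exp_type (fun n => c n + d n).
Proof.
move=> [K [B [K0 KP]]] [L [D [L0 LP]]]; exists (K + L), (Num.max B D).
split=> [|n]; first exact: addr_ge0.
rewrite (le_trans (ler_normcD _ _)) // mulrDl lerD //.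
  apply: le_trans (KP n) _; rewrite ler_wpM2l // ler_expR.
  by rewrite ler_wpM2r ?l1norm_ge0 // le_max lexx.
apply: le_trans (LP n) _; rewrite ler_wpM2l // ler_expR.
by rewrite ler_wpM2r ?l1norm_ge0 // le_max lexx orbT.
Qed.

Lemma exp_type_cst a : exp_type (fun=> a).
Proof.
exists (normc a), 0; split=> [|n]; first exact: normc_ge0.
by rewrite mul0r expR0 mulr1.
Qed.

Lemma exp_type_pairing v : exp_type (fun n => pairing n v).
Proof.
pose S := \sum_k normc (v 0 k).
have S0 : 0 <= S by apply: sumr_ge0 => k _; exact: normc_ge0.
exists S, 1; split=> // n; rewrite mul1r (le_trans (normc_pairing_le n v)) //.
rewrite ler_wpM2l // (le_trans _ (expR_ge1Dx _)) //; lra.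
Qed.

(** The right-hand side is [normc h] times a quantity independent of [h], of
    exponential type when [a] is linear in [n]: the factor [normc a ^+ 2] of
    [cexp_taylor2] is absorbed by [expR (2 * normc a)]. *)
Lemma cexp_quotient_le (a h : C) : h != 0 -> normc h <= 1 ->
  normc (h^-1 * (cexp (h * a) - 1) - a) <= normc h * (4 * expR (3 * normc a)).
Proof.
move=> h0 h1.
rewrite (_ : _ - a = h^-1 * (cexp (h * a) - 1 - h * a)); last first.
  by rewrite [in RHS]mulrBr mulrA mulVf // mul1r.
have nh0 : 0 < normc h.
  by rewrite lt_neqAle normc_ge0 andbT eq_sym; apply: contra_neq h0 => /eq0_normc.
rewrite normcM normcV mulrC ler_pdivrMr //.
apply: (le_trans (cexp_taylor2 _)); rewrite normcM exprMn.
have a0 := normc_ge0 a; set r := normc a in a0 *; set t := normc h in h1 nh0 *.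
have er : expR (t * r) <= expR r by rewrite ler_expR ler_piMl.
have r2 : r ^+ 2 <= expR r ^+ 2.
  rewrite lerXn2r ?nnegrE ?expR_ge0 //.
  by have := expR_ge1Dx r; lra.
have e3 : r ^+ 2 * expR (t * r) <= expR (3 * r).
  rewrite (_ : 3 * r = r + r + r); last by ring.
  rewrite !expRD -expr2 ler_pM ?exprn_ge0 ?expR_ge0 //.
rewrite (_ : 4 * _ * _ = t ^+ 2 * 4 * (r ^+ 2 * expR (t * r))); last by ring.
rewrite (_ : t * _ * t = t ^+ 2 * 4 * expR (3 * r)); last by ring.
by rewrite ler_wpM2l // mulr_ge0 ?exprn_ge0 // ltW.
Qed.

(** Termwise differentiation is legitimate because each difference quotient
    differs from the differentiated term by at most [normc h] times a term of
    an absolutely convergent theta series, by [cexp_quotient_le]. *)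
Lemma derive_theta_series Z c z v : siegel Z -> exp_type c ->
  'D_v (theta_series Z c) z =
  theta_series Z (fun n => 2 * pii R * pairing n v * c n) z.
Proof.
move=> hZ hc.
have hd : exp_type (fun n => 2 * pii R * pairing n v * c n).
  by apply: exp_typeM => //; apply: exp_typeM (exp_type_pairing v);
    exact: exp_type_cst.
pose a n := 2 * pii R * pairing n v.
pose S := normc (2 * pii R) * \sum_k normc (v 0 k).
have aS n : normc (a n) <= S * l1norm n.
  by rewrite normcM -mulrA ler_wpM2l ?normc_ge0 // normc_pairing_le.
have hM : exp_type (fun n => (4 * expR (3 * normc (a n)))%:C * c n).
  apply: exp_typeM => //; exists 4, (3 * S); split=> // n.
  rewrite normc_real ger0_norm ?mulr_ge0 ?expR_ge0 // ler_wpM2l // ler_expR.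
  by rewrite -mulrA ler_wpM2l.
have [M MP] := exp_type_sum_bounded z hZ hM.
have M0 : 0 <= M by have := MP fset0; rewrite big_seq_fset0.
apply: cvg_lim; first exact: norm_hausdorff.
apply/cvgrPdist_le => -[e e'] /[dup] /ltW/ger0_Im /= ->; rewrite ltcR => e0.
near=> h.
have h0 : h != 0 by near: h; exact: (@nbhs_dnbhs_neq C^o).
have h1 : normc h <= 1.
  rewrite -lecR -normcE; near: h; apply: (@dnbhs0_le _ C^o); exact: ltr01.
have he : normc h * (M + 1) <= e.
  rewrite -ler_pdivlMr ?ltr_wpDl // -lecR -normcE; near: h.
  by apply: (@dnbhs0_le _ C^o); rewrite ltcR divr_gt0 // ltr_wpDl.
rewrite distrC normcE lecR.
have quotP : has_sum
    (fun n => h^-1 * (c n * theta_term Z (h *: v + z) n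
                      + (-1) * (c n * theta_term Z z n))
              + (-1) * (2 * pii R * pairing n v * c n * theta_term Z z n))
    (h^-1 * (theta_series Z c (h *: v + z) + (-1) * theta_series Z c z)
     + (-1) * theta_series Z (fun n => 2 * pii R * pairing n v * c n) z).
  apply: has_sumD; last by apply: has_sumZ; exact: theta_seriesP.
  apply: has_sumZ; apply: has_sumD; first exact: theta_seriesP.
  by apply: has_sumZ; exact: theta_seriesP.
rewrite !mulN1r in quotP.
apply: le_trans (@normc_has_sum_le _ _ _ _ (normc h * M) quotP _) _; last first.
  by apply: le_trans he; rewrite ler_wpM2l ?normc_ge0 // lerDl.
move=> A; apply: le_trans (ler_wpM2l (normc_ge0 h) (MP A)).
rewrite mulr_sumr; apply: ler_sum => n _.
rewrite (addrC _ z) theta_term_translate pairingZr.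
rewrite (_ : _ + _ = (h^-1 * (cexp (h * a n) - 1) - a n)
                     * (c n * theta_term Z z n)); last first.
  by rewrite /a (mulrCA h); ring.
move: (theta_term Z z n) => t.
rewrite -(mulrA _ (c n) t) !(normcM _ (c n * t)) [leRHS]mulrA.
rewrite ler_wpM2r ?normc_ge0 //.
rewrite normc_real ger0_norm ?mulr_ge0 ?expR_ge0 //.
exact: cexp_quotient_le.
Unshelve. all: by end_near. Qed.

End ThetaSeries.

(** * Period derivations and translations by a period *)

Section ExtendedTheta.
Variables (R : realType) (g N : nat) (W : 'M[R[i]]_(N, g)) (Z : 'M[R[i]]_g).
Local Notation C := R[i].
Implicit Types (z v : 'rV[C]_g) (n : 'rV[int]_g) (zeta : 'rV[C]_N).
Implicit Types (c : 'rV[int]_g -> C).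

Lemma pairing_delta n mu : pairing n (delta_mx 0 mu) = (n 0 mu)%:~R :> C.
Proof.
rewrite pairingE (bigD1 mu) //= mxE !eqxx mulr1 big1 ?addr0 // => k kmu.
by rewrite mxE eqxx (negbTE kmu) mulr0.
Qed.

Lemma pairingDl n n' v : pairing (n + n') v = pairing n v + pairing n' v.
Proof. by rewrite /pairing map_mxD mulmxDl mxE. Qed.

Lemma pairing_deltal v mu : pairing (delta_mx 0 mu) v = v 0 mu.
Proof. by rewrite /pairing map_delta_mx -rowE !mxE. Qed.

Lemma twopii_neq0 : 2 * pii R != 0.
Proof.
rewrite mulf_neq0 ?pnatr_eq0 // eq_complex /= negb_and.
by rewrite (gt_eqF (pi_gt0 R)) orbT.
Qed.

(** The derivation is diagonal on the terms of the series: the term of index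
    [n] is an eigenvector with eigenvalue [(W n)_i]. *)
Lemma period_derivation_theta_series (i : 'I_N) c : siegel Z -> exp_type c ->
  period_derivation W i (theta_series Z c) =
  theta_series Z (fun n => pairing n (row i W) * c n).
Proof.
move=> hZ hc; apply/funext => z; apply/esym.
have -> : (fun n => pairing n (row i W) * c n) = fun n =>
    \sum_mu W i mu / (2 * pii R) * (2 * pii R * pairing n (delta_mx 0 mu) * c n).
  apply/funext => n; rewrite pairingE mulr_suml; apply: eq_bigr => mu _.
  rewrite pairing_delta mxE; move: twopii_neq0; move: (2 * pii R) => t t0.
  by field.
rewrite /period_derivation; under [RHS]eq_bigr do rewrite derive_theta_series //.
rewrite {1}/theta_series; apply: sum_has_sum.
rewrite (_ : (fun n => _) = fun n => \sum_mu W i mu / (2 * pii R) *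
    (2 * pii R * pairing n (delta_mx 0 mu) * c n * theta_term Z z n)).
  apply: has_sum_sum => mu; apply: has_sumZ; apply: theta_seriesP => //.
  apply: exp_typeM => //; apply: exp_typeM (exp_type_pairing _).
  exact: exp_type_cst.
apply/funext => n; rewrite mulr_suml; apply: eq_bigr => mu _.
by rewrite !mulrA.
Qed.

Lemma exp_type_prod (J : Type) (r : seq J) (P : pred J)
    (F : J -> 'rV[int]_g -> C) : (forall j, exp_type (F j)) ->
  exp_type (fun n => \prod_(j <- r | P j) F j n).
Proof.
move=> hF; elim: r => [|j r IH].
  rewrite (_ : (fun n => _) = fun=> 1); first exact: exp_type_cst.
  by apply/funext => n; rewrite big_nil.
rewrite (_ : (fun n => _) = fun n => (if P j then F j n else 1) *
    \prod_(j <- r | P j) F j n).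
  by apply: exp_typeM IH; case: (P j); [exact: hF | exact: exp_type_cst].
by apply/funext => n; rewrite big_cons; case: (P j); rewrite ?mul1r.
Qed.

Lemma period_derivations_riemann_theta (I : {set 'I_N}) : siegel Z ->
  period_derivations W I (riemann_theta Z) =
  theta_series Z (fun n => \prod_(i in I) pairing n (row i W)).
Proof.
move=> hZ; rewrite /period_derivations.
under [in RHS]eq_fun do rewrite -big_enum /=.
elim: (enum I) => [|i r IH] /=.
  apply/funext => z; congr summability.sum; apply/funext => n.
  by rewrite big_nil mul1r.
rewrite IH period_derivation_theta_series //; last first.
  by apply: exp_type_prod => j; exact: exp_type_pairing.
by congr theta_series; apply/funext => n; rewrite big_cons.
Qed.

(** The eigenvalue on the [n]-th term of the formal product of the operators
    [zeta_i + D_i]. *)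
Definition shifted_symbol zeta n : C := \prod_i (zeta 0 i + pairing n (row i W)).

(** Expanding the product over [i] into a sum over subsets recovers the sum of
    the [zeta^I D_(~: I)]; since the derivations act by scalars on each term,
    their order is irrelevant. *)
Lemma sum_period_derivations zeta z : siegel Z ->
  \sum_(I : {set 'I_N}) (\prod_(i in I) zeta 0 i) *
    period_derivations W (~: I) (riemann_theta Z) z =
  theta_series Z (shifted_symbol zeta) z.
Proof.
move=> hZ; apply/esym; rewrite {1}/theta_series; apply: sum_has_sum.
rewrite (_ : (fun n => _) = fun n => \sum_(I : {set 'I_N})
    (\prod_(i in I) zeta 0 i) *
    (\prod_(i in ~: I) pairing n (row i W) * theta_term Z z n)).
  apply: has_sum_sum => I; apply: has_sumZ.
  rewrite period_derivations_riemann_theta //; apply: theta_seriesP => //.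
  by apply: exp_type_prod => j; exact: exp_type_pairing.
apply/funext => n; rewrite /shifted_symbol bigA_distr mulr_suml.
apply: eq_bigr => I _; rewrite mulrA; congr (_ * _).
rewrite (bigID (mem I)) /=; congr (_ * _); first by apply: eq_bigr => i ->.
by apply: eq_big => [i|i /negbTE ->//]; rewrite finset.in_setC.
Qed.

(** Completing the square: translating [z] by a row of [Z] shifts the summation
    index, up to the automorphy factor. *)
Lemma theta_term_period (alpha : 'I_g) z n : Z^T = Z ->
  theta_term Z (z + row alpha Z) n =
  theta_term Z z (n + delta_mx 0 alpha) *
    cexp (- (2 * pii R * z 0 alpha) - pii R * Z alpha alpha).
Proof.
move=> symZ; rewrite !theta_termE -cexpD; congr cexp.
rewrite pairingDl pairing_deltal pairingDr.
set x := map_mx intr n; set d : 'rV[C]_g := delta_mx 0 alpha.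
rewrite map_mxD map_delta_mx -/x -/d.
have dZ : d *m Z = row alpha Z by rewrite rowE.
have xZd : (x *m Z *m d^T) 0 0 = pairing n (row alpha Z).
  by rewrite -mulmxA -{1}symZ -trmx_mul dZ.
have dZx : (row alpha Z *m x^T) 0 0 = pairing n (row alpha Z).
  by rewrite /pairing -/x -[x in RHS]trmxK -trmx_mul [RHS]mxE.
have dZd : (row alpha Z *m d^T) 0 0 = Z alpha alpha.
  by rewrite -[row alpha Z]trmxK -trmx_mul -rowE !mxE.
rewrite mulmxDl [(x + d)^T]linearD /= mulmxDr !mulmxDl dZ.
have add00 (A B : 'M[C]_1) : (A + B) 0 0 = A 0 0 + B 0 0 by rewrite mxE.
by rewrite !add00 xZd dZx dZd; ring.
Qed.

(** The same shift of the index is what the translation of [zeta] by the periods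
    [W_alpha] amounts to, because
    [(W (n + e_alpha))_i = (W n)_i + W_(i, alpha)]. *)
Lemma shifted_symbol_translate (alpha : 'I_g) zeta n :
  shifted_symbol (zeta + (col alpha W)^T) n =
  shifted_symbol zeta (n + delta_mx 0 alpha).
Proof.
by apply: eq_bigr => i _; rewrite pairingDl pairing_deltal !mxE -addrA (addrC (W i _)).
Qed.

Lemma exp_type_shifted_symbol zeta : exp_type (shifted_symbol zeta).
Proof.
apply: exp_type_prod => i; apply: exp_typeD; first exact: exp_type_cst.
exact: exp_type_pairing.
Qed.

(** Both translations become the relabelling [n |-> n + e_alpha] of the lattice,
    under which an unconditional sum is invariant. *)
Lemma theta_series_period (alpha : 'I_g) zeta z : siegel Z ->
  theta_series Z (shifted_symbol (zeta + (col alpha W)^T)) (z + row alpha Z) =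
  theta_series Z (shifted_symbol zeta) z *
    cexp (- (2 * pii R * z 0 alpha) - pii R * Z alpha alpha).
Proof.
move=> hZ; rewrite {1}/theta_series; apply: sum_has_sum; rewrite mulrC.
set e := cexp _; set delta : 'rV[int]_g := delta_mx 0 alpha.
have := theta_seriesP z hZ (exp_type_shifted_symbol zeta).
move=> /(has_sum_reindex (addrK delta) (subrK delta)) /(has_sumZ e).
congr has_sum; apply/funext => n /=.
by rewrite shifted_symbol_translate theta_term_period ?(proj1 hZ) // mulrC
  [RHS]mulrA.
Qed.

End ExtendedTheta.

(** * Quasi-periodicity of the extended theta function *)

Theorem lemma6p3 (R : realType) (g M N : nat)
    (Z : 'M[R[i]]_g) (Y : 'M[R[i]]_(g, M)) (W : 'M[R[i]]_(N, g))
    (nu : 'I_M -> 'rV[R[i]]_g)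
    (hZ : siegel Z)
    (hnu : forall (j : 'I_M) (alpha : 'I_g),
       Y alpha j = 2 * pii R * nu j 0 alpha)
    (alpha : 'I_g)
    (xi : 'rV[R[i]]_M) (zeta : 'rV[R[i]]_N) (z : 'rV[R[i]]_g) :
  extended_theta Z W nu
    (xi + row alpha Y) (zeta + (col alpha W)^T) (z + row alpha Z) =
  extended_theta Z W nu xi zeta z *
    cexp (- (2 * pii R * z 0 alpha) - pii R * Z alpha alpha).
Proof.
have extended_thetaE xi' zeta' z' : extended_theta Z W nu xi' zeta' z' =
    \sum_(J : {set 'I_M}) cexp (\sum_(j in J) xi' 0 j) *
      theta_series Z (shifted_symbol W zeta') (z' + \sum_(j in J) nu j).
  apply: eq_bigr => J _; rewrite -sum_period_derivations // mulr_sumr.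
  by apply: eq_bigr => I _; rewrite cexp_sum mulrA.
rewrite !extended_thetaE mulr_suml; apply: eq_bigr => J _.
rewrite addrAC theta_series_period // mulrCA -cexpD -[RHS]mulrA.
rewrite [RHS]mulrCA -cexpD; congr (_ * cexp _).
(* the periods [Y_alpha] added to [xi] compensate the change of the automorphy
   factor caused by the translation by the sum of the [nu j] *)
have -> : \sum_(j in J) (xi + row alpha Y) 0 j =
    \sum_(j in J) xi 0 j + 2 * pii R * (\sum_(j in J) nu j) 0 alpha.
  rewrite summxE mulr_sumr -big_split /=.
  by apply: eq_bigr => j _; rewrite !mxE hnu.
rewrite mxE; ring.
Qed.
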